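(* Let $p\ge 1$ be an integer and let $a,b$ be integers with $1\le a<b\le \lfloor\frac{5p-1}{2}\rfloor$ and $a\not\equiv 0 \pmod 5$, $b\not\equiv 0\pmod 5$. Then the circulant graph $C_{5p}(a,b)$ is Type I, i.e. its total chromatic number equals $5$.
   Context: For integers $n$ and $1\le d_1<d_2<\dots<d_l\le\lfloor n/2\rfloor$, the circulant graph $C_n(d_1,\dots,d_l)$ has vertex set $\{0,1,\dots,n-1\}$, with $x$ and $y$ adjacent iff $x\equiv y\pm d_i \pmod n$ for some $i$. The paper considers four-regular circulant graphs $C_n(a,b)$ with $1\le a<b\le\lfloor\frac{n-1}{2}\rfloor$. A total coloring of a graph $G$ assigns colors to vertices and edges so that adjacent vertices receive different colors, adjacent (incident-to-a-common-vertex) edges receive different colors, and each edge receives a color different from its two endpoints. The total chromatic number $\chi''(G)$ is the minimum number of colors in a total coloring; always $\chi''(G)\ge\Delta(G)+1$. A graph is Type I if $\chi''(G)=\Delta(G)+1$. *)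

(* Defs.v *)
From mathcomp Require Import all_boot.

Set Implicit Arguments.
Unset Strict Implicit.
Unset Printing Implicit Defensive.

(* A finite simple graph is given by a symmetric irreflexive adjacency relation
   [e] on a finType of vertices; its edges are the 2-element sets {x, y} with
   [e x y]. *)

Definition edge_set (T : finType) (e : rel T) : {set {set T}} :=
  [set [set p.1; p.2] | p : T * T & e p.1 p.2].

Definition edge (T : finType) (e : rel T) := {E : {set T} | E \in edge_set e}.

Definition max_degree (T : finType) (e : rel T) : nat :=
  \max_(x : T) #|[set y | e x y]|.

Definition is_total_coloring (T : finType) (e : rel T) (k : nat)
    (cv : {ffun T -> 'I_k}) (ce : {ffun edge e -> 'I_k}) : bool :=
  [&& [forall x : T, forall y : T, e x y ==> (cv x != cv y)],
      [forall E : edge e, forall F : edge e,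
         (E != F) && (val E :&: val F != set0) ==> (ce E != ce F)]
    & [forall x : T, forall E : edge e, (x \in val E) ==> (cv x != ce E)]].

Definition total_colorable (T : finType) (e : rel T) (k : nat) : bool :=
  [exists cv : {ffun T -> 'I_k}, exists ce : {ffun edge e -> 'I_k},
     is_total_coloring cv ce].

(* A relation rather than a function: a relation with a loop has no total
   coloring at all.  For irreflexive [e] exactly one [k] qualifies; see
   [total_chromatic_number_exists] and [total_chromatic_number_unique]. *)
Definition is_total_chromatic_number (T : finType) (e : rel T) (k : nat)
    : Prop :=
  total_colorable e k /\ (forall m, total_colorable e m -> k <= m).

Definition type_I (T : finType) (e : rel T) : Prop :=
  is_total_chromatic_number e (max_degree e).+1.

(* x = y - d (mod n) is written x + d = y (mod n), as subtraction on nat is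
   truncated.  This is a simple graph when 0 < d < n for all d in ds. *)
Definition circulant (n : nat) (ds : seq nat) : rel 'I_n :=
  fun x y => has (fun d => (x == y + d %[mod n]) || (x + d == y %[mod n])) ds.

Lemma total_chromatic_number_exists (T : finType) (e : rel T) :
  irreflexive e -> exists k, is_total_chromatic_number e k.
Proof.
move=> e_irr; have ex : exists k, total_colorable e k.
  exists #|{: T + edge e}|; apply/existsP.
  exists [ffun x => enum_rank (inl x : T + edge e)]; apply/existsP.
  exists [ffun E => enum_rank (inr E : T + edge e)]; apply/and3P; split.
  - apply/forallP=> x; apply/forallP=> y; apply/implyP=> exy; rewrite !ffunE.
    by apply/eqP=> /enum_rank_inj[xy]; rewrite xy e_irr in exy.
  - apply/forallP=> E; apply/forallP=> F; apply/implyP=> /andP[nEF _].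
    by rewrite !ffunE; apply/eqP=> /enum_rank_inj[EF]; rewrite EF eqxx in nEF.
  - apply/forallP=> x; apply/forallP=> E; apply/implyP=> _.
    by rewrite !ffunE; apply/eqP=> /enum_rank_inj.
by case: (ex_minnP ex) => k ck kmin; exists k.
Qed.

Lemma total_chromatic_number_unique (T : finType) (e : rel T) (k m : nat) :
  is_total_chromatic_number e k -> is_total_chromatic_number e m -> k = m.
Proof.
by move=> [ck kmin] [cm mmin]; apply/eqP; rewrite eqn_leq kmin // mmin.
Qed.

Lemma circulant_sym (n : nat) (ds : seq nat) : symmetric (@circulant n ds).
Proof.
by move=> x y; apply: eq_has => d; rewrite orbC eq_sym [X in _ || X]eq_sym.
Qed.

Lemma circulant_irr (n : nat) (ds : seq nat) :
  all (fun d => 0 < d < n) ds -> irreflexive (@circulant n ds).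
Proof.
move=> /allP ds_n x; apply/hasP=> -[d /ds_n /andP[d_gt0 d_lt_n]].
rewrite [X in X || _]eq_sym orbb -[X in _ == X %[mod n]]addn0 eqn_modDl.
by rewrite mod0n modn_small // gtn_eqF.
Qed.

(* Main.v *)
(** Color the vertex x with x mod 5, the edge {x, x + a} with x + s and the edge
    {x, x + b} with x + t.  The four edges at x then receive x + s, x + (s - a),
    x + t and x + (t - b), so the coloring is proper as soon as
    {s, s - a, t, t - b} is the set of nonzero residues mod 5; as a and b are
    nonzero mod 5, such s and t always exist. *)
Require Import Defs.
From mathcomp Require Import all_boot.
From mathcomp Require Import zify.

(** * Edges as two-element sets, and total colorings of general graphs *)

Lemma edge_setP (T : finType) (e : rel T) (E : {set T}) :
  reflect (exists x y, e x y /\ E = [set x; y]) (E \in edge_set e).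
Proof.
apply: (iffP imsetP) => [[[x y]] | [x [y [exy ->]]]].
  by rewrite inE => exy ->; exists x, y.
by exists (x, y); rewrite ?inE.
Qed.

Lemma edge_set_at (T : finType) (e : rel T) (E : {set T}) x :
  symmetric e -> E \in edge_set e -> x \in E ->
  exists y, e x y /\ E = [set x; y].
Proof.
move=> e_sym /edge_setP[u [v [euv ->]]]; rewrite !inE => /orP[]/eqP->.
  by exists v.
by exists u; rewrite e_sym setUC.
Qed.

Lemma set2_inj (T : finType) (x : T) : injective (fun y => [set x; y]).
Proof.
move=> y z /setP eqyz; have := eqyz y; have := eqyz z.
by rewrite !inE !eqxx !orbT; case: eqP => [->|_] /=; case: eqP => // ->; case: eqP.
Qed.

(** Two distinct edges conflict only through a common endpoint [x], so a function [ce] on ordered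
    pairs suffices: symmetry along edges makes it a function of the edge, and injectivity on the
    neighbors of each [x] makes it proper. *)
Lemma total_colorable_local (T : finType) (e : rel T) (k : nat)
    (cv : T -> 'I_k) (ce : T -> T -> 'I_k) :
    symmetric e ->
    (forall x y, e x y -> cv x != cv y) ->
    (forall x y, e x y -> ce x y = ce y x) ->
    (forall x y z, e x y -> e x z -> ce x y = ce x z -> y = z) ->
    (forall x y, e x y -> cv x != ce x y) ->
  total_colorable e k.
Proof.
move=> e_sym cv_proper ce_sym ce_inj cv_ce.
have ends (E : edge e) : exists p, e p.1 p.2 && (val E == [set p.1; p.2]).
  by have /edge_setP[x [y [exy ->]]] := valP E; exists (x, y); rewrite exy eqxx.
(* [xchoose] fixes an arbitrary orientation of each edge; [cE] shows that the color does not depend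
   on it. *)
pose c E := let p := xchoose (ends E) in ce p.1 p.2.
have cE (E : edge e) x y : e x y -> val E = [set x; y] -> c E = ce x y.
  move=> exy Exy; rewrite /c; case: (xchoose _) (xchooseP (ends E)) => u v /=.
  case/andP=> euv /eqP Euv0; have {Euv0} Euv : val E = [set u; v] := Euv0.
  have: u \in [set x; y] by rewrite -Exy Euv set21.
  rewrite !inE => /orP[]/eqP eq_u; subst u; move: Euv; rewrite Exy.
    by move/set2_inj->.
  by rewrite setUC => /set2_inj->; exact: ce_sym.
apply/existsP; exists [ffun x => cv x].
apply/existsP; exists [ffun E => c E]; apply/and3P; split.
- by apply/'forall_forallP=> x y; apply/implyP=> /cv_proper; rewrite !ffunE.
- apply/'forall_forallP=> E F; apply/implyP=> /andP[neqEF /set0Pn[x]].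
  rewrite inE !ffunE => /andP[xE xF].
  have [y [exy Exy]] := edge_set_at _ _ _ _ e_sym (valP E) xE.
  have [z [exz Fxz]] := edge_set_at _ _ _ _ e_sym (valP F) xF.
  rewrite (cE E x y) // (cE F x z) //; apply: contraNneq neqEF.
  by move/(ce_inj _ _ _ exy exz)=> eq_yz; apply/eqP/val_inj; rewrite Exy Fxz eq_yz.
- apply/'forall_forallP=> x E; apply/implyP=> xE; rewrite !ffunE.
  have [y [exy Exy]] := edge_set_at _ _ _ _ e_sym (valP E) xE.
  by rewrite (cE E x y) // cv_ce.
Qed.

(** The edges at [x] have pairwise distinct colors, none of which is the color of [x], so they fill
    a proper subset of the [k] colors. *)
Lemma degree_lt_total_colorable (T : finType) (e : rel T) (k : nat) x :
  total_colorable e k -> #|[set y | e x y]| < k.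
Proof.
case/existsP=> cv /existsP[ce /and3P[_ /'forall_forallP edges /'forall_forallP inc]].
have xy_edge y : e x y -> [set x; y] \in edge_set e.
  by move=> exy; apply/edge_setP; exists x, y.
(* The default [cv x] is never taken on a neighbor of [x], by [fE]. *)
pose f y := if insub [set x; y] is Some E then ce E else cv x.
have fE y (exy : e x y) : f y = ce (Sub [set x; y] (xy_edge y exy)).
  by rewrite /f (insubT (fun E => E \in edge_set e) (xy_edge y exy)).
have f_inj : {in [set y | e x y] &, injective f}.
  move=> y z; rewrite !inE => exy exz eq_f.
  apply/eqP/negP=> neq_yz.
  set E : edge e := Sub [set x; y] (xy_edge y exy).
  set F : edge e := Sub [set x; z] (xy_edge z exz).
  have := edges E F; rewrite -!fE eq_f eqxx implybF => /negP; apply.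
  apply/andP; split.
    by rewrite -val_eqE /=; apply/eqP=> /set2_inj/eqP.
  by apply/set0Pn; exists x; rewrite /= !inE eqxx.
rewrite -(card_in_imset f_inj) -[X in _ < X]card_ord -cardsT.
apply: proper_card; rewrite properT; apply/negP=> /eqP/setP/(_ (cv x)).
rewrite inE => /imsetP[y]; rewrite inE => exy; rewrite (fE y exy) => cvE.
have := inc x (Sub [set x; y] (xy_edge y exy)).
by rewrite -cvE eqxx /= set21.
Qed.

(** The vertex [x0] makes the maximum degree equal to [d] and supplies the lower bound [d.+1] on the
    number of colors. *)
Lemma type_I_regular (T : finType) (e : rel T) (d : nat) (x0 : T) :
    (forall x, #|[set y | e x y]| = d) -> total_colorable e d.+1 ->
  type_I e /\ is_total_chromatic_number e d.+1.
Proof.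
move=> e_reg col.
have -> : type_I e = is_total_chromatic_number e d.+1.
  congr (is_total_chromatic_number e _.+1).
  apply/eqP; rewrite /max_degree eqn_leq; apply/andP; split.
    by apply/bigmax_leqP=> x _; rewrite e_reg.
  by rewrite -(e_reg x0); exact: leq_bigmax.
have chi : is_total_chromatic_number e d.+1.
  by split=> // m /(degree_lt_total_colorable _ _ _ x0); rewrite e_reg.
by split.
Qed.

(** Here [4 * a] encodes [-a] modulo 5. Only the residues of [a] and [b] matter, so a finite search
    over the sixteen pairs of nonzero residues settles the claim. *)
Lemma residues_mod5 (a b : nat) : a <> 0 %[mod 5] -> b <> 0 %[mod 5] ->
  exists s t, perm_eq [seq m %% 5 | m <- [:: s; s + 4 * a; t; t + 4 * b]]
                      [:: 1; 2; 3; 4].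
Proof.
move=> a0 b0.
have nonzero c : c <> 0 %[mod 5] -> c %% 5 \in iota 1 4.
  by rewrite mem_iota; lia.
have finite_check : all (fun r => all (fun q => has (fun s => has (fun t =>
    perm_eq [seq m %% 5 | m <- [:: s; s + 4 * r; t; t + 4 * q]] [:: 1; 2; 3; 4])
    (iota 0 5)) (iota 0 5)) (iota 1 4)) (iota 1 4) by vm_compute.
have /allP/(_ _ (nonzero _ a0))/allP/(_ _ (nonzero _ b0)) := finite_check.
case/hasP=> s _ /hasP[t _ st]; exists s, t; move: st => /=.
by rewrite -modnDmr modnMmr modnDmr -[(t + _) %% 5]modnDmr modnMmr modnDmr.
Qed.

(** * Differences modulo n and the neighbors in a circulant graph *)

Definition diff (n : nat) (x y : 'I_n) : nat := (y + (n - x)) %% n.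

Lemma diff_inj (n : nat) (x y z : 'I_n) : diff n x y = diff n x z -> y = z.
Proof.
move/eqP; rewrite /diff eqn_modDr !modn_small // => /eqP; exact: val_inj.
Qed.

Lemma diff_add (n : nat) (x y : 'I_n) : y = x + diff n x y %[mod n].
Proof.
rewrite /diff modnDmr; have -> : x + (y + (n - x)) = y + n by have := ltn_ord x; lia.
by rewrite modnDr.
Qed.

(** Difference zero is excluded: its opposite is 0, not [n]. *)
Lemma diff_opp (n : nat) (x y : 'I_n) :
  0 < diff n x y -> diff n y x = n - diff n x y.
Proof.
have [ltx lty] := (ltn_ord x, ltn_ord y); rewrite /diff.
have [le_xy|lt_yx] := leqP x y; last first.
  rewrite (modn_small (m := y + _)); last lia.
  have -> : x + (n - y) = x - y + n by lia.
  rewrite modnDr modn_small; lia.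
have -> : y + (n - x) = y - x + n by lia.
rewrite modnDr (modn_small (m := y - x)) => [lt_xy|]; last lia.
rewrite modn_small; lia.
Qed.

(** With [n - d] standing for [-d], the two congruences of the adjacency relation become values of
    one difference. Degrees and edge colors are then read off a list. *)
Lemma circulantE (n : nat) (ds : seq nat) (x y : 'I_n) :
    all (fun d => 0 < d < n) ds ->
  @circulant n ds x y = (diff n x y \in ds ++ [seq n - d | d <- ds]).
Proof.
move=> /allP ds_n; have n_gt0 : 0 < n by have := ltn_ord x; lia.
have step d : d < n -> (x + d == y %[mod n]) = (diff n x y == d).
  move=> dn; rewrite (diff_add n x y) eqn_modDl (modn_small dn) eq_sym.
  by rewrite /diff modn_mod.
have back d : 0 < d < n -> (x == y + d %[mod n]) = (diff n x y == n - d).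
  move=> /andP[d0 dn]; rewrite -step; last lia.
  by rewrite -[RHS](eqn_modDr d) -addnA (subnK (ltnW dn)) modnDr.
rewrite mem_cat; apply/hasP/orP => [[d d_ds]|].
  rewrite step ?back; [|exact: ds_n|by case/andP: (ds_n _ d_ds)].
  by case/orP=> /eqP->; [right; apply: map_f|left].
case=> [dxy|/mapP[d d_ds dxy]].
  exists (diff n x y) => //.
  by rewrite step ?eqxx ?orbT //; case/andP: (ds_n _ dxy).
by exists d => //; rewrite back ?dxy ?eqxx //; exact: ds_n.
Qed.

(** [diff n x] maps the neighbors of [x] bijectively onto the connection list. Uniqueness of its
    entries rules out coincidences such as [d = n - d], which would lower the degree. *)
Lemma circulant_degree (n : nat) (ds : seq nat) (x : 'I_n) :
    all (fun d => 0 < d < n) ds -> uniq (ds ++ [seq n - d | d <- ds]) ->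
  #|[set y | @circulant n ds x y]| = 2 * size ds.
Proof.
move=> ds_n ds_uniq; set D := ds ++ _ in ds_uniq.
have n_gt0 : 0 < n by have := ltn_ord x; lia.
rewrite cardE -(size_map (diff n x)).
have -> : 2 * size ds = size D by rewrite size_cat size_map mul2n addnn.
apply: perm_size; apply: uniq_perm => //.
  by rewrite map_inj_uniq ?enum_uniq // => y z; apply: diff_inj.
move=> d; apply/mapP/idP => [[y]|dD].
  by rewrite mem_enum inE circulantE // => ? ->.
have dn : d < n.
  move: dD; rewrite mem_cat => /orP[|/mapP[c]] /(allP ds_n); lia.
pose y := Ordinal (ltn_pmod (x + d) n_gt0).
have dxy : d = diff n x y.
  apply/eqP; rewrite -(modn_small dn) -(modn_small (m := diff n x y) (d := n)).
    by rewrite -(eqn_modDl x) -diff_add /= modn_mod.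
  exact: ltn_pmod.
by exists y => //; rewrite mem_enum inE circulantE // -dxy.
Qed.

(** The edge leaving [x] with difference [d] is colored [x + phi d]. The last hypothesis says that
    its other end [x + d], which sees the difference [-d], computes the same color; the others
    separate, in order, adjacent vertices, an edge from its ends, and two edges at a vertex. *)
Lemma circulant_total_colorable5 (p : nat) (ds : seq nat) (phi : nat -> nat)
    (D := ds ++ [seq 5 * p - d | d <- ds]) :
    all (fun d => 0 < d < 5 * p) ds ->
    (forall d, d \in D -> d <> 0 %[mod 5]) ->
    (forall d, d \in D -> phi d <> 0 %[mod 5]) ->
    {in D &, forall d c, phi d = phi c %[mod 5] -> d = c} ->
    (forall d, d \in D -> phi d = d + phi (5 * p - d) %[mod 5]) ->
  total_colorable (@circulant (5 * p) ds) 5.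
Proof.
move=> ds_n D0 phi0 phi_inj phi_opp.
set n := 5 * p in D ds_n D0 phi0 phi_inj phi_opp *.
pose color m : 'I_5 := Ordinal (ltn_pmod m (isT : 0 < 5)).
have color_eq m k : (color m == color k) = (m == k %[mod 5]) by [].
(* Since 5 divides [n], congruences modulo [n] descend to congruences modulo 5. *)
have diff_mod5 (x y : 'I_n) : y = x + diff n x y %[mod 5].
  have n5 : 5 %| n by rewrite dvdn_mulr.
  by rewrite -(modn_dvdm y n5) (diff_add n x y) modn_dvdm.
have D_gt0 d : d \in D -> 0 < d by case: d => // /D0.
apply: (total_colorable_local _ _ _ (fun x : 'I_n => color x)
         (fun x y : 'I_n => color (x + phi (diff n x y)))) => [|x y|x y|x y z|x y];
  first exact: circulant_sym.
all: rewrite circulantE // -/D => dxy.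
- have := D0 _ dxy; have := diff_mod5 x y; rewrite color_eq; lia.
- apply/eqP; rewrite color_eq (diff_opp _ x y) ?D_gt0 //.
  have := phi_opp _ dxy; have := diff_mod5 x y; lia.
- rewrite circulantE // -/D => dxz /eqP; rewrite color_eq eqn_modDl => /eqP.
  by move/(phi_inj _ _ dxy dxz)/diff_inj.
- have := phi0 _ dxy; rewrite color_eq; lia.
Qed.

Theorem theorem2p1 (p a b : nat) (hp : 1 <= p)
    (ha : 1 <= a) (hab : a < b) (hb : b <= (5 * p - 1) %/ 2)
    (ha5 : a <> 0 %[mod 5]) (hb5 : b <> 0 %[mod 5]) :
  type_I (@circulant (5 * p) [:: a; b]) /\
  is_total_chromatic_number (@circulant (5 * p) [:: a; b]) 5.
Proof.
(* This strict bound gives [a < b < 5 * p - b < 5 * p - a]: four distinct differences, hence degree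
   4. *)
have b_lt : 2 * b < 5 * p by lia.
have ds_n : all (fun d => 0 < d < 5 * p) [:: a; b] by rewrite /=; lia.
have n_gt0 : 0 < 5 * p by lia.
apply: (type_I_regular _ _ 4 (Ordinal n_gt0)) => [x|].
  by rewrite circulant_degree //= !inE; lia.
have [s [t st]] := residues_mod5 _ _ ha5 hb5.
have [st_mem st_uniq] := (perm_mem st, perm_uniq st).
(* The offsets of the differences [a], [-a], [b], [-b] are [s], [s - a], [t], [t - b]; the last
   branch serves [5 * p - b]. *)
pose phi d := if d == a then s else if d == 5 * p - a then s + 4 * a
              else if d == b then t else t + 4 * b.
have phi_a : phi a = s by rewrite /phi eqxx.
have phi_na : phi (5 * p - a) = s + 4 * a.
  by rewrite /phi eqxx; case: eqP => //; lia.
have phi_b : phi b = t.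
  by rewrite /phi eqxx; do 2 (case: eqP => [|_]; first lia).
have phi_nb : phi (5 * p - b) = t + 4 * b.
  by rewrite /phi; do 3 (case: eqP => [|_]; first lia).
have {}st_uniq : uniq [seq m %% 5 | m <- [:: s; s + 4 * a; t; t + 4 * b]].
  by rewrite st_uniq.
have st0 m : m \in [:: s; s + 4 * a; t; t + 4 * b] -> m <> 0 %[mod 5].
  move=> /(map_f (modn^~ 5)); rewrite st_mem !inE; lia.
apply: (circulant_total_colorable5 _ _ phi) => //=.
- move=> d; rewrite !inE; lia.
- move=> d d_mem; apply: st0; move: d_mem; rewrite !inE.
  by case/or4P=> /eqP->; rewrite ?phi_a ?phi_na ?phi_b ?phi_nb eqxx ?orbT.
- move: st_uniq; rewrite /= !inE => st_uniq d c; rewrite !inE.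
  by case/or4P=> /eqP->; case/or4P=> /eqP->;
    rewrite ?phi_a ?phi_na ?phi_b ?phi_nb //; lia.
(* Compatibility of opposite differences reduces to [s = a + (s - a)] and [s - a = -a + s] modulo 5,
   and likewise for [b] and [t]. *)
- have [na nb] : 5 * p - (5 * p - a) = a /\ 5 * p - (5 * p - b) = b by lia.
  move=> d; rewrite !inE; case/or4P=> /eqP->;
    rewrite ?na ?nb ?phi_a ?phi_na ?phi_b ?phi_nb; lia.
Qed.
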